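(* Let $k\ge t\ge 2$ and $\lambda\ge 1$ be integers. Then the class $\overrightarrow{P\mathcal D}_{kt\lambda}$ of all finite linearly ordered partial $(k,t,\lambda)$-designs (with embeddings as described in the context) is a Ramsey class: for every $\mathbf A,\mathbf B\in\overrightarrow{P\mathcal D}_{kt\lambda}$ and every positive integer $r$ there exists $\mathbf C\in\overrightarrow{P\mathcal D}_{kt\lambda}$ such that for every partition of $\binom{\mathbf C}{\mathbf A}$ into $r$ classes there is $\widetilde{\mathbf B}\in\binom{\mathbf C}{\mathbf B}$ with $\binom{\widetilde{\mathbf B}}{\mathbf A}$ contained in a single class.
   Context: A partial $(k,t,\lambda)$-design is a finite hypergraph $(X,R)$ with $R\subseteq\binom{X}{k}$ such that every $t$-element subset of $X$ is contained in at most $\lambda$ members (blocks) of $R$. For a $t$-subset $T$, its neighbourhood $N(T)$ is the union of all blocks containing $T$; it has size $0$ or between $k$ and $K=(k-t)\lambda+t$. In the paper such a design is encoded as a structure $\mathbf A=(A,R_{\mathbf A},(F^\ell_{\mathbf A})_{k\le\ell\le K})$ where $R_{\mathbf A}$ is the set of ordered $k$-tuples of distinct vertices whose underlying set is a block, and $F^\ell_{\mathbf A}$ is a partial function defined exactly on those $t$-tuples $(v_1,\dots,v_t)$ with $|N(\{v_1,\dots,v_t\})|=\ell$, with value the (unordered) set $N(\{v_1,\dots,v_t\})$. $\overrightarrow{P\mathcal D}_{kt\lambda}$ consists of these structures expanded by an arbitrary linear order $\le$ of the vertex set. An embedding $f:\mathbf A\to\mathbf B$ is an injective order-preserving map $f:A\to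 B$ such that (i) a $k$-subset $M\subseteq A$ is a block of $\mathbf A$ iff $f(M)$ is a block of $\mathbf B$, and (ii) for each $\ell$ and $t$-tuple $\vec x$ of $A$, $\vec x\in\mathrm{dom}(F^\ell_{\mathbf A})$ iff $f(\vec x)\in\mathrm{dom}(F^\ell_{\mathbf B})$, and then $f(F^\ell_{\mathbf A}(\vec x))=F^\ell_{\mathbf B}(f(\vec x))$. Equivalently, (ii) may be replaced by: every block of $\mathbf B$ that is not the image of a block of $\mathbf A$ meets $f(A)$ in at most $t-1$ elements. $\binom{\mathbf B}{\mathbf A}$ denotes the set of all images of embeddings $\mathbf A\to\mathbf B$ (copies of $\mathbf A$ in $\mathbf B$). *)

(* Defs.v *)
From HB Require Import structures.
From mathcomp Require Import all_boot.

Set Implicit Arguments.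
Unset Strict Implicit.
Unset Printing Implicit Defensive.

Record ordPD (k t lam : nat) := OrdPD {
  vertex :> finType;
  blocks : {set {set vertex}};
  vle : rel vertex;
  card_block : forall M, M \in blocks -> #|M| = k;
  card_blocks_over : forall T : {set vertex},
    #|T| = t -> #|[set M in blocks | T \subset M]| <= lam;
  vle_anti : antisymmetric vle;
  vle_trans : transitive vle;
  (* totality includes reflexivity *)
  vle_total : total vle
}.

Section Embeddings.
Variables k t lam : nat.
Implicit Types A B D : ordPD k t lam.

Definition nbhd D (T : {set D}) : {set D} :=
  \bigcup_(M in blocks D | T \subset M) M.

(* The partial function F^l on t-tuples; None means "undefined". The entries
   are required to be distinct since nbhd is meant for t-subsets only. *)
Definition nbhd_fun D (l : nat) (x : t.-tuple D) : option {set D} :=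
  let N := nbhd [set v in x] in
  if uniq x && (#|N| == l) then Some N else None.

(* In emb_nbhd, equality of options says both that x is in the domain of F^l_A
   iff f x is in the domain of F^l_B, and that the values then correspond. *)
Record embedding A B (f : A -> B) : Prop := Embedding {
  emb_inj : injective f;
  emb_le : {homo f : x y / vle x y};
  emb_blocks : forall M : {set A},
    #|M| = k -> (M \in blocks A) = (f @: M \in blocks B);
  emb_nbhd : forall l, k <= l <= (k - t) * lam + t ->
    forall x : t.-tuple A,
      nbhd_fun l (map_tuple f x) = omap (fun N : {set A} => f @: N) (nbhd_fun l x)
}.

(* A copy is represented by its vertex set S. By emb_blocks and emb_nbhd, the
   image of an embedding contains the neighbourhoods of its t-subsets, so the
   structure it carries, functions included, is the one induced on S. *)
Definition copy A B (S : {set B}) : Prop :=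
  exists2 f : A -> B, embedding f & S = f @: [set: A].

Section Induced.
Variables (D : ordPD k t lam) (S : {set D}).
Let V : finType := {x : D | x \in S}.

Definition induced_blocks : {set {set V}} :=
  [set M : {set V} | val @: M \in blocks D].

Definition induced_le : rel V := fun x y => vle (val x) (val y).

Lemma card_induced_block M : M \in induced_blocks -> #|M| = k.
Proof.
by rewrite inE => MD; rewrite -(card_block MD) card_imset //; apply: val_inj.
Qed.

Lemma card_induced_blocks_over (T : {set V}) :
  #|T| = t -> #|[set M in induced_blocks | T \subset M]| <= lam.
Proof.
move=> cT; have cvT : #|val @: T| = t by rewrite card_imset //; apply: val_inj.
apply: leq_trans (card_blocks_over cvT).
rewrite -(card_imset _ (imset_inj (@val_inj _ _ V))).
apply/subset_leq_card/subsetP => _ /imsetP[M MT ->].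
move: MT; rewrite !inE => /andP[MD TM].
by rewrite MD imsetS.
Qed.

Lemma induced_le_anti : antisymmetric induced_le.
Proof. by move=> x y /vle_anti /val_inj. Qed.

Lemma induced_le_trans : transitive induced_le.
Proof. by move=> y x z; apply: vle_trans. Qed.

Lemma induced_le_total : total induced_le.
Proof. by move=> x y; apply: vle_total. Qed.

Definition induced : ordPD k t lam :=
  OrdPD card_induced_block card_induced_blocks_over
        induced_le_anti induced_le_trans induced_le_total.

End Induced.

(* The copies of A in the structure induced on S, as vertex sets of D. *)
Definition copy_within A D (S : {set D}) (U : {set D}) : Prop :=
  exists2 U' : {set induced S}, copy A U' & U = [set val x | x in U'].

End Embeddings.

(* Main.v *)
Require Import Defs.
From HB Require Import structures.
From mathcomp Require Import all_boot.

Set Implicit Arguments.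
Unset Strict Implicit.
Unset Printing Implicit Defensive.

(* Partite construction over the parts [0 .. n]: start with disjoint copies of
   [B], one over each map [B -> 'I_n.+1], then treat the maps [alpha] from [A]
   to the parts one after the other.  For [alpha], take the closed copies of [A]
   lying over [alpha] as the alphabet of a Hales-Jewett cube and glue copies of
   the current design, one for each line of the cube, along the vertices over
   the image of [alpha].  With all lines this breaks the bound [lam]: two
   parallel lines may share a t-set that no copy of [A] over [alpha] contains,
   and blocks through it would accumulate.  We therefore only use a family of
   lines with pairwise distinct active sets (which still has the Hales-Jewett
   property); then two glued copies meet inside a copy of [A], which is closed,
   so that the gluing is a free amalgamation.  At the end the colour of a copy
   of [A] depends only on the parts it meets, and Ramsey's theorem for subsets
   of the set of parts finishes the proof. *)

(** * Hales-Jewett theorem and its sparse version *)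

Definition join_ffun (I J : finType) (T : Type) (f : {ffun I -> T})
    (g : {ffun J -> T}) : {ffun I + J -> T} :=
  [ffun s => match s with inl i => f i | inr j => g j end].

Section Lines.
Variable G : finType.

(* In a combinatorial line, [None] marks the active coordinates. *)
Definition line (I : finType) := {ffun I -> option G}.

Definition active (I : finType) (l : line I) := [exists i, l i == None].

Definition same_active (I : finType) (l m : line I) :=
  forall i, (l i == None) = (m i == None).

Definition line_at (I : finType) (l : line I) (a : G) : {ffun I -> G} :=
  [ffun i => odflt a (l i)].

Definition const_line (I : finType) (p : {ffun I -> G}) : line I :=
  [ffun i => Some (p i)].

Lemma line_at_const (I : finType) (p : {ffun I -> G}) a :
  line_at (const_line p) a = p.
Proof. by apply/ffunP=> i; rewrite !ffunE. Qed.

Lemma line_at_join (I J : finType) (l : line I) (m : line J) a :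
  line_at (join_ffun l m) a = join_ffun (line_at l a) (line_at m a).
Proof. by apply/ffunP=> -[i|j]; rewrite !ffunE. Qed.

Lemma active_joinl (I J : finType) (l : line I) (m : line J) :
  active l -> active (join_ffun l m).
Proof.
by move=> /existsP[i li]; apply/existsP; exists (inl i); rewrite ffunE.
Qed.

Lemma active_joinr (I J : finType) (l : line I) (m : line J) :
  active m -> active (join_ffun l m).
Proof.
by move=> /existsP[i li]; apply/existsP; exists (inr i); rewrite ffunE.
Qed.

Definition mono_on (I : finType) (K : Type) (chi : {ffun I -> G} -> K)
    (S : {set G}) (l : line I) :=
  {in S &, forall a b, chi (line_at l a) = chi (line_at l b)}.

(** Colour focusing: such lines, though monochromatic only on [S], are to meet in one common point
    [f] at the letter [z]. *)
Definition focused (I : finType) (K : Type) (chi : {ffun I -> G} -> K)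
    (S : {set G}) (z : G) (f : {ffun I -> G}) (l : line I) :=
  [/\ active l, mono_on chi S l & line_at l z = f].

(** Induction on [s]. A line [M] monochromatic for the colouring by whole slices prolongs every
    focused line, and [M] joined with the constant line at [f] gives one more. If the colour of [f]
    repeats that of an old line, this line is already monochromatic on [z |: S]. *)
Lemma hales_jewett_focus (S : {set G}) (z a0 : G) (K : finType) :
    a0 \in S ->
    (forall K' : finType, exists I : finType, forall chi : {ffun I -> G} -> K',
      exists2 l : line I, active l & mono_on chi S l) ->
  forall s : nat, exists I : finType, forall chi : {ffun I -> G} -> K,
    (exists2 l : line I, active l & mono_on chi (z |: S) l) \/
    exists f (ls : seq (line I)),
      [/\ size ls = s, forall l, l \in ls -> focused chi S z f l &
          uniq [seq chi (line_at l a0) | l <- ls]].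
Proof.
move=> a0S HJ; elim=> [|s [I IH]].
  exists unit => chi; right.
  by exists [ffun=> z], [::]; split.
have [I1 HJ1] := HJ {ffun {ffun I -> G} -> K}.
exists (I1 + I)%type => chi.
have [M actM monoM] := HJ1 (fun y => [ffun x => chi (join_ffun y x)]).
have chiM a x : a \in S ->
    chi (join_ffun (line_at M a) x) = chi (join_ffun (line_at M a0) x).
  by move=> aS; have /ffunP/(_ x) := monoM a a0 aS a0S; rewrite !ffunE.
pose chi0 x := chi (join_ffun (line_at M a0) x).
have lift l : active l -> mono_on chi0 (z |: S) l ->
    exists2 l : line (I1 + I)%type, active l & mono_on chi (z |: S) l.
  move=> actl monol; exists (join_ffun (const_line (line_at M a0)) l).
    exact: active_joinr.
  by move=> a b aS bS; rewrite !line_at_join !line_at_const; apply: monol.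
have [[l actl monol]|[f [ls [sz foc un]]]] := IH chi0.
  by left; apply: lift monol.
have [fcol|fcol] := boolP (chi0 f \in [seq chi0 (line_at l a0) | l <- ls]).
  have /mapP[l lls fl] := fcol; have [actl monol lz] := foc _ lls.
  left; apply: (lift l) => //.
  have lS a : a \in z |: S -> chi0 (line_at l a) = chi0 (line_at l a0).
    by rewrite !inE => /orP[/eqP->|aS]; [rewrite lz | apply: monol].
  by move=> a b aS bS; rewrite !lS.
right; exists (join_ffun (line_at M z) f).
exists (join_ffun M (const_line f) :: [seq join_ffun M l | l <- ls]); split.
- by rewrite /= size_map sz.
- move=> l; rewrite inE => /orP[/eqP->|/mapP[m mls ->]]; split.
  + exact: active_joinl.
  + by move=> a b aS bS; rewrite !line_at_join !line_at_const !(chiM _ _ _).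
  + by rewrite line_at_join line_at_const.
  + exact: active_joinl.
  + move=> a b aS bS; rewrite !line_at_join !chiM //.
    by have [_ monom _] := foc _ mls; apply: monom.
  + by rewrite line_at_join; have [_ _ ->] := foc _ mls.
- rewrite /= line_at_join line_at_const -map_comp.
  rewrite (eq_map (g := fun l => chi0 (line_at l a0))) ?fcol ?un // => l.
  by rewrite /= line_at_join.
Qed.

(** Induction on [#|S|], removing a letter [z]: [#|K|.+1] focused lines cannot have pairwise
    distinct colours. *)
Lemma hales_jewett_on (S : {set G}) (K : finType) :
  exists I : finType, forall chi : {ffun I -> G} -> K,
    exists2 l : line I, active l & mono_on chi S l.
Proof.
elim: {S}#|S| {-2}S (erefl #|S|) K => [|n IH] S cS K.
  exists unit => chi; exists [ffun=> None].
    by apply/existsP; exists tt; rewrite ffunE.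
  by move=> a b; rewrite (cards0_eq cS) inE.
have /card_gt0P[z zS] : 0 < #|S| by rewrite cS.
have cS' : #|S :\ z| = n by move: (cardsD1 z S); rewrite zS cS => -[].
have [S'0|/set0Pn[a0 a0S]] := eqVneq (S :\ z) set0.
  exists unit => chi; exists [ffun=> None].
    by apply/existsP; exists tt; rewrite ffunE.
  move=> a b; rewrite -(setD1K zS) S'0 setU0 !inE.
  by move=> /eqP-> /eqP->.
have [I HI] := hales_jewett_focus z K a0S (IH _ cS') #|K|.+1.
exists I => chi; have := HI chi; rewrite setD1K //.
case=> // -[f [ls [sz _ /card_uniqP un]]].
by have := max_card (mem [seq chi (line_at l a0) | l <- ls]);
   rewrite un size_map sz ltnn.
Qed.

End Lines.

(** * Lines with pairwise distinct active sets *)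

Section Sparse.
Variables G I0 : finType.

(* A family of lines in [G^(J + I0)], split into their [J]- and [I0]-parts;
   the [I0]-part is thought of as the projection to a base cube. *)
Definition sparse_over (J : finType) (F : {set line G J * line G I0}) :=
  (forall p, p \in F -> active p.2) /\
  {in F &, forall p q, same_active p.1 q.1 -> p = q}.

Definition lifts_over (J J' : finType) (F : {set line G J * line G I0})
    (F' : {set line G J' * line G I0})
    (E : {ffun J -> G} -> {ffun I0 -> G} -> {ffun J' -> G}) :=
  forall p, p \in F -> exists2 x' : line G J', (x', p.2) \in F' &
    forall a, E (line_at p.1 a) (line_at p.2 a) = line_at x' a.

Variable K : finType.

(** Hales-Jewett with the whole fibre [{ffun J -> G}] as alphabet: embedding the fibre along a line
    [M] monochromatic over [w] makes the colour over [w] forget the point of the fibre. *)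
Lemma sparse_step (w : {ffun I0 -> G}) (J : finType)
    (F : {set line G J * line G I0}) : sparse_over F ->
  exists (J' : finType) (F' : {set line G J' * line G I0}), sparse_over F' /\
    forall chi : {ffun J' -> G} -> {ffun I0 -> G} -> K,
      exists2 E, lifts_over F F' E &
        forall x y, chi (E x w) w = chi (E y w) w.
Proof.
move=> [actF spF]; have [I1 HJ] := hales_jewett_on [set: {ffun J -> G}] K.
pose L := line {ffun J -> G} I1.
(* In the lift along [M], slot [(M, i)] repeats base coordinate [i] and the
   other slots carry [w].  Hence slot [M] is active in a lifted line exactly
   when the lift is along [M], while over [w] all lifts agree on the slots. *)
pose E (M : L) x u : {ffun (I1 * J) + (L * I0) -> G} :=
  join_ffun [ffun p => line_at M x p.1 p.2]
            [ffun q => if q.1 == M then u q.2 else w q.2].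
pose EL (M : L) (x : line G J) (b : line G I0) :
    line G ((I1 * J) + (L * I0))%type :=
  join_ffun [ffun p => if M p.1 is Some y then Some (y p.2) else x p.2]
            [ffun q => if q.1 == M then b q.2 else Some (w q.2)].
pose F' := [set (EL M p.1 p.2, p.2) | M in [set M : L | active M], p in F].
exists ((I1 * J) + (L * I0))%type, F'; split.
  split=> [_ /imset2P[M p _ Fp ->]|]; first exact: actF.
  move=> _ _ /imset2P[M p actM Fp ->] /imset2P[M' p' _ Fp' ->] /= same.
  have MM' : M = M'.
    have /existsP[i bi] := actF _ Fp.
    have := same (inr (M, i)); rewrite !ffunE /= eqxx bi.
    by case: (eqVneq M M').
  rewrite -MM' in same *; move: actM; rewrite inE => /existsP[i /eqP Mi].
  suff -> : p = p' by [].
  by apply: spF => // j; have := same (inl (i, j)); rewrite !ffunE /= Mi.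
move=> chi; have [M actM mono] :=
  HJ (fun y => chi (join_ffun [ffun p => y p.1 p.2] [ffun q => w q.2]) w).
exists (E M) => [p Fp|x y].
  exists (EL M p.1 p.2).
    by apply/imset2P; exists M p; rewrite ?inE.
  move=> a; apply/ffunP=> -[[i j]|[M' i]]; rewrite !ffunE /=.
    by case: (M i) => [y|] /=; rewrite ?ffunE.
  by case: eqVneq => //=; rewrite ffunE.
have EM z : E M z w =
    join_ffun [ffun p => line_at M z p.1 p.2] [ffun q => w q.2].
  by congr join_ffun; apply/ffunP=> q; rewrite !ffunE if_same.
by rewrite !EM; apply: mono; rewrite inE.
Qed.

Lemma sparse_iter (ws : seq {ffun I0 -> G}) (J : finType)
    (F : {set line G J * line G I0}) : sparse_over F ->
  exists (J' : finType) (F' : {set line G J' * line G I0}), sparse_over F' /\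
    forall chi : {ffun J' -> G} -> {ffun I0 -> G} -> K,
      exists2 E, lifts_over F F' E &
        forall w x y, w \in ws -> chi (E x w) w = chi (E y w) w.
Proof.
elim: ws J F => [|w ws IH] J F spF.
  exists J, F; split=> // chi; exists (fun x _ => x) => // -[x b] Fp.
  by exists x.
have [J1 [F1 [spF1 HF1]]] := sparse_step w spF.
have [J2 [F2 [spF2 HF2]]] := IH _ _ spF1.
(* The last map is chosen first: [E1] depends on the colouring pulled back along [E2]. *)
exists J2, F2; split=> // chi; have [E2 lE2 cE2] := HF2 chi.
have [E1 lE1 cE1] := HF1 (fun x u => chi (E2 x u) u).
exists (fun x u => E2 (E1 x u) u) => [p /lE1[x1 /lE2[x2 Fx2 e2] e1]|].
  by exists x2 => // a; rewrite e1 e2.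
by move=> v x y; rewrite inE => /orP[/eqP->|/cE2]; auto.
Qed.

End Sparse.

(* Pulling lines apart over the cube of the Hales-Jewett theorem, one point of
   that cube at a time, makes their active sets pairwise distinct. *)
Lemma sparse_hales_jewett (G K : finType) :
  exists (I : finType) (F : {set line G I}),
    [/\ forall l, l \in F -> active l,
        {in F &, forall l m, same_active l m -> l = m} &
        forall chi : {ffun I -> G} -> K,
          exists2 l, l \in F & forall a b, chi (line_at l a) = chi (line_at l b)].
Proof.
(* An empty alphabet has no letter [g0] to fill inactive coordinates. *)
have [/eqP G0|/card_gt0P[g0 _]] := posnP #|G|.
  exists unit, [set [ffun=> None]]; split.
  - by move=> l /set1P->; apply/existsP; exists tt; rewrite ffunE.
  - by move=> l m /set1P-> /set1P->.
  - move=> chi; exists [ffun=> None]; rewrite ?inE // => a.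
    by move: G0; rewrite -cardsT cards_eq0 => /eqP/setP/(_ a); rewrite !inE.
have [I0 HJ] := hales_jewett_on [set: G] K.
(* Each base line gets a private coordinate, active for it alone, so the initial family is
   sparse. *)
pose x0 (b : line G I0) : line G (line G I0) :=
  [ffun b' => if b' == b then None else Some g0].
pose F0 := [set (x0 b, b) | b in [set b : line G I0 | active b]].
have spF0 : sparse_over F0.
  split=> [p /imsetP[b]|p q /imsetP[b _ ->] /imsetP[c _ ->] /(_ b)].
    by rewrite inE => actb ->.
  by rewrite /= !ffunE eqxx; case: (eqVneq b c) => [->|].
have [J [F [[actF spF] HF]]] := sparse_iter K (enum {ffun I0 -> G}) spF0.
exists (J + I0)%type, [set join_ffun p.1 p.2 | p in F]; split.
- by move=> _ /imsetP[p Fp ->]; apply/active_joinr/actF.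
- move=> _ _ /imsetP[p Fp ->] /imsetP[q Fq ->] same.
  suff -> : p = q by [].
  by apply: spF => // j; have := same (inl j); rewrite !ffunE.
- move=> chi; have [E lE cE] := HF (fun x u => chi (join_ffun x u)).
  (* Over each base point the colour no longer depends on the fibre, so an arbitrary [p0] defines
     the colouring of the base cube. *)
  pose p0 : {ffun line G I0 -> G} := [ffun=> g0].
  have [b actb mono] := HJ (fun u => chi (join_ffun (E p0 u) u)).
  have [|x' Fx' e] := lE (x0 b, b).
    by apply: imset_f; rewrite inE.
  have chiE a : chi (line_at (join_ffun x' b) a) =
      chi (join_ffun (E p0 (line_at b a)) (line_at b a)).
    rewrite line_at_join -e /=; apply: cE.
    by rewrite mem_enum.
  exists (join_ffun x' b); first by apply/imsetP; exists (x', b).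
  by move=> a1 a2; rewrite !chiE; apply: mono; rewrite inE.
Qed.

(** * Ramsey's theorem *)

(** Separate targets [m c] allow an induction on their sum: on a long tail [s1] all [x :: v] with
    [v] of length [a] get one colour, and the target of this colour then drops by one. *)
Lemma ramsey (K : finType) (c0 : K) (a n : nat) :
  exists N : nat, forall (T : eqType) (s : seq T) (chi : seq T -> K)
      (m : K -> nat),
    \sum_c m c <= n -> N <= size s ->
    exists c, exists2 u, subseq u s & size u = m c /\
      forall v, subseq v u -> size v = a -> chi v = c.
Proof.
elim: a n => [|a IHa].
  move=> n; exists n => T s chi m mn ns; exists (chi [::]), (take (m (chi [::])) s).
    exact: take_subseq.
  split; last by move=> v _ /size0nil->.
  rewrite size_takel // (leq_trans _ ns) // (leq_trans _ mn) //.
  by rewrite (bigD1 (chi [::])) //= leq_addr.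
elim=> [|n [Q HQ]].
  exists 0 => T s chi m; rewrite leqn0 sum_nat_eq0 => /forallP/(_ c0)/eqP m0 _.
  exists c0, [::]; first exact: sub0seq.
  by split=> // v /eqP->.
have [N HN] := IHa (#|K| * Q).
exists N.+1 => T [//|x s] chi m mn; rewrite [_ < _]ltnS => Ns.
(* A zero target is met by the empty sequence, which has no subsequence of length [a.+1]. *)
have [[d /eqP d0]|mpos] := altP (@existsP _ (fun d => m d == 0)).
  exists d, [::]; first exact: sub0seq.
  by split=> // v /eqP->.
have [|c [s1 s1s [sz1 hom1]]] := HN T s (fun v => chi (x :: v)) (fun=> Q) _ Ns.
  by rewrite sum_nat_const.
pose m' d := if d == c then (m d).-1 else m d.
have mc : 0 < m c by rewrite lt0n; apply: contra mpos => mc; apply/existsP; exists c.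
have m'n : \sum_d m' d <= n.
  rewrite (bigD1 c) //= {1}/m' eqxx (eq_bigr m) => [|d /negPf dc]; last first.
    by rewrite /m' dc.
  by move: mn; rewrite (bigD1 c) //= -{1}(prednK mc) addSn ltnS.
have [|d [u us1 [szu homu]]] := HQ T s1 chi m' m'n; first by rewrite sz1.
have us : subseq u s := subseq_trans us1 s1s.
have [dc|dc] := eqVneq d c; last first.
  exists d, u; last by rewrite szu /m' (negPf dc).
  exact: subseq_trans us (subseq_cons s x).
exists c, (x :: u); first by rewrite /= eqxx.
split=> [|[//|y v]]; first by rewrite /= szu /m' dc eqxx prednK.
rewrite /= => + [szv]; case: eqVneq => [->|_] sub.
  by apply: hom1 => //; apply: subseq_trans us1.
by rewrite -dc; apply: homu => //=; rewrite szv.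
Qed.

(** * Partite construction *)

Definition partial_design (k t lam : nat) (V : finType) (R : {set {set V}}) :=
  (forall M, M \in R -> #|M| = k) /\
  forall T : {set V}, #|T| = t -> #|[set M in R | T \subset M]| <= lam.

(** * Closed embeddings of set systems *)

Section ClosedEmbeddings.
Variable t : nat.

(** The order-free content of an embedding when [t <= k]: the last clause replaces the neighbourhood
    functions, see [embedding_closed] and [closed_embedding]. *)
Definition closed_emb (U V : finType) (Q : {set {set U}}) (R : {set {set V}})
    (f : U -> V) : bool :=
  [&& injectiveb f, [forall (M | M \in Q), f @: M \in R] &
      [forall (W | W \in R), (t <= #|W :&: f @: [set: U]|) ==>
        [exists (M | M \in Q), W == f @: M]]].

Lemma closed_embP (U V : finType) (Q : {set {set U}}) (R : {set {set V}})
    (f : U -> V) :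
  reflect [/\ injective f, forall M, M \in Q -> f @: M \in R &
      forall W, W \in R -> t <= #|W :&: f @: [set: U]| ->
        exists2 M, M \in Q & W = f @: M]
    (closed_emb Q R f).
Proof.
apply: (iffP and3P) => -[inj hom cl]; split.
- exact/injectiveP.
- exact/forall_inP.
- move=> W WR tW; have /exists_inP[M MQ /eqP->] := implyP (forall_inP cl W WR) tW.
  by exists M.
- exact/injectiveP.
- exact/forall_inP.
- apply/forall_inP=> W WR; apply/implyP=> /(cl W WR)[M MQ ->].
  by apply/exists_inP; exists M.
Qed.

Variables (U V X : finType).
Variables (Q : {set {set U}}) (R : {set {set V}}) (S : {set {set X}}).

Lemma eq_closed_emb (f g : U -> V) :
  f =1 g -> closed_emb Q R f -> closed_emb Q R g.
Proof.
move=> fg /closed_embP[inj hom cl]; apply/closed_embP; split.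
- exact: eq_inj inj fg.
- by move=> M; rewrite -(eq_imset _ fg); apply: hom.
- move=> W WR; rewrite -(eq_imset _ fg) => /(cl W WR)[M MQ ->].
  by exists M; rewrite // (eq_imset _ fg).
Qed.

Lemma card_imset_meet (f : U -> V) (g : V -> X) (W : {set V}) : injective g ->
  #|g @: W :&: (g \o f) @: [set: U]| = #|W :&: f @: [set: U]|.
Proof.
by move=> inj; rewrite imset_comp -imsetI ?card_imset // => x y _ _ /inj.
Qed.

Lemma closed_emb_comp (f : U -> V) (g : V -> X) :
  closed_emb Q R f -> closed_emb R S g -> closed_emb Q S (g \o f).
Proof.
move=> /closed_embP[injf homf clf] /closed_embP[injg homg clg].
apply/closed_embP; split=> [|M MQ|W WS tW]; first exact: inj_comp.
  by rewrite imset_comp; apply/homg/homf.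
have [|M MR eW] := clg W WS.
  by apply: leq_trans tW _; apply/subset_leq_card/setIS; rewrite imset_comp imsetS.
have [|M' M'Q eM] := clf M MR; first by rewrite -(card_imset_meet f _ injg) -eW.
by exists M'; rewrite // imset_comp -eM.
Qed.

(** By [t <= k], the image of a block of [Q] meets the image of [g] in at least [t] vertices, so
    closedness of [g] pulls it back. *)
Lemma closed_emb_cancel k (f : U -> V) (g : V -> X) : t <= k ->
    (forall M, M \in Q -> #|M| = k) ->
  closed_emb Q S (g \o f) -> closed_emb R S g -> closed_emb Q R f.
Proof.
move=> tk cardQ /closed_embP[injf homf clf] /closed_embP[injg homg clg].
have injf' : injective f by move=> x y /(congr1 g) /injf.
apply/closed_embP; split=> // [M MQ|W WR tW].
  have [||W WR e] := clg (g @: (f @: M)).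
  - by rewrite -imset_comp; apply: homf.
  - rewrite (setIidPl _) ?imsetS ?subsetT //.
    by rewrite !card_imset // (cardQ _ MQ).
  by rewrite (imset_inj injg e).
have [||M MQ e] := clf (g @: W); first exact: homg.
  by rewrite card_imset_meet.
by exists M => //; apply: (imset_inj injg); rewrite -imset_comp.
Qed.

End ClosedEmbeddings.

(** * Gluing one copy per line of the cube *)

Section PartiteStep.
Variables (k t lam : nat).
Variables (A V J : finType) (QA : {set {set A}}) (R : {set {set V}}).
Variables (pi : V -> J) (alpha : {ffun A -> J}).
Hypotheses (alpha_inj : injective alpha) (desR : partial_design k t lam R).

Definition copy_over (h : {ffun A -> V}) :=
  closed_emb t QA R h && [forall v, pi (h v) == alpha v].

Definition copies_over := {h : {ffun A -> V} | copy_over h}.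

Implicit Types f g : copies_over.

Lemma pi_copy f v : pi (val f v) = alpha v.
Proof. by have /andP[_ /forallP/(_ v)/eqP] := valP f. Qed.

Lemma copy_closed f : closed_emb t QA R (val f).
Proof. by have /andP[] := valP f. Qed.

(** Closedness of [g] turns the block [val f @: M] into a block of the copy [g]; as [alpha] is
    injective, the parts then identify the vertices one by one. *)
Lemma copies_agree f g M : M \in QA ->
    t <= #|[set v in M | val f v == val g v]| -> {in M, val f =1 val g}.
Proof.
move=> MQ tM; have /closed_embP[injf homf _] := copy_closed f.
have /closed_embP[_ _ clg] := copy_closed g.
have [||M' M'Q e] := clg (val f @: M); first exact: homf.
  apply: leq_trans tM _; rewrite -(card_imset _ injf).
  apply/subset_leq_card/subsetP=> _ /imsetP[v + ->]; rewrite inE => /andP[vM /eqP e].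
  by rewrite inE imset_f //= e imset_f.
move=> v vM; have : val f v \in val g @: M' by rewrite -e imset_f.
case/imsetP=> v' _ e'; rewrite e'.
by have := congr1 pi e'; rewrite !pi_copy => /alpha_inj->.
Qed.

Variables (I : finType) (F : {set line copies_over I}).
Hypothesis actF : forall l, l \in F -> active l.
Hypothesis sparseF : {in F &, forall l m, same_active l m -> l = m}.

Implicit Types l m : line copies_over I.

(* Copies of [V] indexed by the lines are glued along the vertices over the
   image of [alpha] only: the second component separates all other vertices. *)
Definition glued : finType := ({ffun I -> V} * option (line copies_over I) * J)%type.

(** The vertex of [A] sharing the part of [x]; [None] means that this part is outside the image of
    [alpha]. *)
Definition slot (x : V) : option A := [pick v | alpha v == pi x].

Lemma slot_copy f v : slot (val f v) = Some v.
Proof.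
rewrite /slot; case: pickP => [w /eqP|/(_ v)]; rewrite pi_copy ?eqxx //.
by move=> /alpha_inj->.
Qed.

Definition transport f (x : V) : V := if slot x is Some v then val f v else x.

Definition glue (l : line copies_over I) (x : V) : glued :=
  ([ffun i => if l i is Some f then transport f x else x],
   if slot x is Some _ then None else Some l, pi x).

Lemma glue_inj l : active l -> injective (glue l).
Proof.
move=> /existsP[i /eqP li] x y [/ffunP/(_ i)].
by rewrite !ffunE li.
Qed.

(** The copy [f] inside the copy glued along [l] depends only on the point [line_at l f], which is
    how copies of [A] become points of the cube. *)
Lemma glue_copy l f v :
  glue l (val f v) =
  ([ffun i => (val (line_at l f i) v : V)], None, alpha v) :> glued.
Proof.
rewrite /glue slot_copy pi_copy; congr (_, _, _).
apply/ffunP=> i; rewrite !ffunE.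
by case: (l i) => [g|//]; rewrite /transport slot_copy.
Qed.

(* At a coordinate active in [l] only, a common vertex shows its preimage under
   [glue l] on one side and a vertex of a fixed copy of [A] on the other; a
   coordinate active in [m] then does the same for the preimage under [glue m]. *)
Lemma glue_meet_aux l m i : active m -> l i = None -> m i != None ->
  exists f g, forall x y, glue l x = glue m y ->
    exists v, x = val f v /\ y = val g v.
Proof.
move=> /existsP[j /eqP mj] li; case mi : (m i) => [f|//] _.
pose g := if l j is Some g then g else f.
exists f, g => x y []; move=> /ffunP e.
case sx : (slot x) => [v|]; last first.
  case sy : (slot y) => [//|] [lm]; by rewrite -lm li in mi.
case sy : (slot y) => [w|//] _ pixy.
have vw : v = w.
  by move: sx sy; rewrite /slot pixy => -> [].
have xE : x = val f v.
  by have := e i; rewrite !ffunE li mi /transport sy -vw.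
exists v; split=> //.
have := e j; rewrite !ffunE mj /g.
by case: (l j) => [h|]; rewrite ?/transport ?sx => <-.
Qed.

(** Sparseness gives a coordinate active in exactly one of the two lines, as [glue_meet_aux]
    requires up to exchanging them. *)
Lemma glue_meet l m : l \in F -> m \in F -> l != m ->
  exists f g, forall x y, glue l x = glue m y ->
    exists v, x = val f v /\ y = val g v.
Proof.
move=> lF mF lm.
have [/existsP[i neq]|/existsPn same] := boolP [exists i, (l i == None) != (m i == None)].
  have [li|lx] := eqVneq (l i) None.
    apply: (glue_meet_aux (i := i)) => //; first exact: actF.
    by move: neq; rewrite li; case: (m i == None).
  have mi : m i = None by apply/eqP; move: neq; rewrite (negPf lx); case: (m i == None).
  have [f [g fg]] := glue_meet_aux (actF lF) mi lx.
  exists g, f => x y /esym/fg[v [-> ->]]; by exists v.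
case/eqP: lm; apply: sparseF => // i.
by have := same i; rewrite negbK => /eqP.
Qed.

Definition glued_blocks : {set {set glued}} :=
  [set glue l @: (W : {set V}) | l in F, W in R].

(** A block from another line [m] meets the copy of [l] inside a copy [g] of [A]. With [t] common
    vertices, closedness of [g] puts the whole block in [g], and it coincides with a block of the
    copy [f] on the side of [l]. *)
Lemma glue_closed l : l \in F -> closed_emb t R glued_blocks (glue l).
Proof.
move=> lF; have injl := glue_inj (actF lF).
apply/closed_embP; split=> // [M MR|_ /imset2P[m W mF WR ->]].
  by apply/imset2P; exists l M.
have [->|lm] := eqVneq l m; first by move=> _; exists W.
have [f [g fg]] := glue_meet lF mF lm.
have /closed_embP[injf homf _] := copy_closed f.
have /closed_embP[injg _ clg] := copy_closed g.
set Y := _ :&: _ => tY.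
have YE z : z \in Y -> exists v, [/\ val g v \in W, z = glue m (val g v) &
    glue l (val f v) = glue m (val g v)].
  rewrite inE => /andP[/imsetP[y yW ->] /imsetP[x _ e]].
  have [v [xE yE]] := fg _ _ (esym e); exists v.
  by rewrite -yE -xE.
have [|M MQ WE] := clg W WR.
  apply: leq_trans tY _; rewrite -(card_imset (_ :&: _) (glue_inj (actF mF))).
  apply/subset_leq_card/subsetP=> z /YE[v [gW -> _]].
  by rewrite imset_f // inE gW imset_f.
(* At each coordinate two copies of [A] are compared; the vertices behind [Y] show that they agree
   on at least [t] elements of [M]. *)
have agree v : v \in M -> glue l (val f v) = glue m (val g v).
  move=> vM; rewrite !glue_copy; congr (_, _, _); apply/ffunP=> i; rewrite !ffunE.
  apply: (copies_agree MQ) => //; apply: leq_trans tY _.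
  rewrite -(card_imset _ injg) -(card_imset (_ @: _) (glue_inj (actF mF))).
  apply/subset_leq_card/subsetP=> z /YE[w [gW -> e]].
  apply/imset_f/imset_f; rewrite inE; apply/andP; split.
    by move: gW; rewrite WE => /imsetP[w' w'M /injg->].
  move: e; rewrite !glue_copy => -[/ffunP/(_ i)]; rewrite !ffunE => /eqP.
  by [].
exists (val f @: M); first exact: homf.
rewrite WE -!imset_comp; apply: eq_in_imset => v vM /=.
by rewrite agree.
Qed.

(** A covered [t]-set lies in one glued copy, and by closedness all blocks over it come from that
    copy. *)
Lemma glued_design : partial_design k t lam glued_blocks.
Proof.
have [cardR degR] := desR.
split=> [_ /imset2P[l W lF WR ->]|T cT].
  by rewrite card_imset ?cardR //; apply/glue_inj/actF.
have [->|/set0Pn[W0]] := eqVneq [set M in glued_blocks | T \subset M] set0.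
  by rewrite cards0.
rewrite inE => /andP[/imset2P[l W lF WR ->] TW].
have injl := glue_inj (actF lF).
have cov : T \subset glue l @: setT by apply: subset_trans TW _; apply: imsetS.
pose T0 := glue l @^-1: T.
have TE : T = glue l @: T0.
  apply/setP=> z; apply/idP/imsetP=> [zT|[x]]; last by rewrite inE => + ->.
  by have /imsetP[x _ e] := subsetP cov z zT; exists x; rewrite // inE -e.
have cT0 : #|T0| = t by rewrite -cT TE card_imset.
apply: leq_trans (degR _ cT0).
rewrite -(card_imset _ (imset_inj injl)); apply/subset_leq_card/subsetP=> W'.
rewrite inE => /andP[W'R TW'].
have /closed_embP[_ _ cl] := glue_closed lF.
have [|M MR e] := cl W' W'R.
  by rewrite -cT; apply/subset_leq_card; rewrite subsetI TW'.
rewrite e; apply/imset_f; rewrite inE MR; apply/subsetP=> x xT.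
have : glue l x \in glue l @: M by rewrite -e (subsetP TW') // TE imset_f.
by rewrite (mem_imset _ _ injl).
Qed.

End PartiteStep.

Section PartiteConstruction.
Variables (k t lam : nat) (A J K : finType) (QA : {set {set A}}).

Lemma partite_step (alpha : {ffun A -> J}) (V : finType) (R : {set {set V}})
    (pi : V -> J) :
    injective alpha -> partial_design k t lam R ->
  exists (V' : finType) (R' : {set {set V'}}) (pi' : V' -> J),
    partial_design k t lam R' /\
    forall chi : {set V'} -> K,
      exists2 phi : V -> V', closed_emb t R R' phi /\ pi' \o phi =1 pi &
        forall h g, copy_over t QA R pi alpha h -> copy_over t QA R pi alpha g ->
          chi (phi @: (h @: setT)) = chi (phi @: (g @: setT)).
Proof.
move=> alpha_inj desR.
have [I [F [actF sparseF HJ]]] := sparse_hales_jewett (copies_over t QA R pi alpha) K.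
exists (glued t QA R pi alpha I), (glued_blocks F), (fun z => z.2); split.
  exact: glued_design.
move=> chi; pose img (p : {ffun I -> copies_over t QA R pi alpha}) :
    {set glued t QA R pi alpha I} :=
  [set ([ffun i => val (p i) v], None, alpha v) | v in [set: A]].
have [l lF mono] := HJ (fun p => chi (img p)).
exists (glue l); first by split=> //; apply: glue_closed.
move=> h g oh og; pose h' : copies_over t QA R pi alpha := Sub h oh.
pose g' : copies_over t QA R pi alpha := Sub g og.
have imgE (f : copies_over t QA R pi alpha) :
    glue l @: (val f @: setT) = img (line_at l f).
  by rewrite -imset_comp; apply: eq_imset => v /=; rewrite glue_copy.
by have := mono h' g'; rewrite -!imgE.
Qed.

(** One [partite_step] per [alpha]; closed embeddings keep copies over the remaining maps, so later
    steps apply to their images. *)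
Lemma partite_construction (alphas : seq {ffun A -> J}) (V : finType)
    (R : {set {set V}}) (pi : V -> J) :
    (forall alpha, alpha \in alphas -> injective alpha) ->
    partial_design k t lam R ->
  exists (V' : finType) (R' : {set {set V'}}) (pi' : V' -> J),
    partial_design k t lam R' /\
    forall chi : {set V'} -> K,
      exists2 phi : V -> V', closed_emb t R R' phi /\ pi' \o phi =1 pi &
        forall alpha, alpha \in alphas -> forall h g,
          copy_over t QA R pi alpha h -> copy_over t QA R pi alpha g ->
          chi (phi @: (h @: setT)) = chi (phi @: (g @: setT)).
Proof.
elim: alphas V R pi => [|alpha alphas IH] V R pi injs desR.
  exists V, R, pi; split=> // chi; exists id => //; split=> //.
  apply/closed_embP; split=> // [M MR|W WR _]; first by rewrite imset_id.
  by exists W; rewrite // imset_id.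
have [V1 [R1 [pi1 [des1 H1]]]] := partite_step pi (injs _ (mem_head _ _)) desR.
have [|V2 [R2 [pi2 [des2 H2]]]] := IH V1 R1 pi1 _ des1.
  by move=> a aas; apply: injs; rewrite inE aas orbT.
exists V2, R2, pi2; split=> // chi.
have [phi2 [cl2 e2] mono2] := H2 chi.
have [phi1 [cl1 e1] mono1] := H1 (fun S => chi (phi2 @: S)).
exists (phi2 \o phi1).
  by split=> [|x]; [apply: closed_emb_comp cl2 | rewrite -(e1 x); apply: e2].
move=> a; rewrite inE => /orP[/eqP->|aas] h g oh og.
  rewrite (imset_comp _ _ (h @: _)) (imset_comp _ _ (g @: _)).
  exact: mono1.
have push (f : {ffun A -> V}) : copy_over t QA R pi a f ->
    copy_over t QA R1 pi1 a (finfun (phi1 \o f)).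
  move=> /andP[clf /forallP of_]; apply/andP; split.
    by apply: eq_closed_emb (closed_emb_comp clf cl1) => v; rewrite ffunE.
  by apply/forallP=> v; rewrite ffunE [pi1 _](e1 (f v)).
have imE (f : {ffun A -> V}) : phi1 @: (f @: setT) = finfun (phi1 \o f) @: setT.
  by rewrite -imset_comp; apply: eq_imset => v; rewrite ffunE.
rewrite (imset_comp _ _ (h @: _)) (imset_comp _ _ (g @: _)) !imE.
by apply: (mono2 a) => //; apply: push.
Qed.

End PartiteConstruction.

(** * Ordered designs *)

Section OrderedDesigns.
Variables k t lam : nat.
Implicit Types A B D : ordPD k t lam.

Lemma vle_refl D (x : D) : vle x x.
Proof. by have := vle_total x x; rewrite orbb. Qed.

(** At most [lam] blocks each add [k - t] vertices to [T]. The bound places [#|nbhd T|] in the range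
    where [emb_nbhd] speaks. *)
Lemma card_nbhd_le D (T : {set D}) : #|T| = t -> #|nbhd T| <= (k - t) * lam + t.
Proof.
move=> cT; pose E := [set M in blocks D | T \subset M].
have ND : nbhd T \subset T :|: \bigcup_(M in E) (M :\: T).
  apply/subsetP=> x /bigcupP[M MT xM]; rewrite inE.
  have [//|xT /=] := boolP (x \in T).
  by apply/bigcupP; exists M; rewrite inE ?xT.
apply: leq_trans (subset_leq_card ND) _.
apply: leq_trans (leq_card_setU _ _) _; rewrite cT addnC leq_add2r.
have le_sum : #|\bigcup_(M in E) (M :\: T)| <= \sum_(M in E) (k - t).
  apply: (big_ind2 (fun (S : {set D}) m => #|S| <= m)) => [|S a S' b Sa S'b|M].
  - by rewrite cards0.
  - by apply: leq_trans (leq_card_setU _ _) _; apply: leq_add.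
  - rewrite inE => /andP[MD TM].
    by rewrite cardsD (setIidPr TM) (card_block MD) cT.
apply: leq_trans le_sum _.
by rewrite sum_nat_const mulnC leq_mul2l card_blocks_over ?orbT.
Qed.

(** If a block [W] contains the image of a [t]-tuple [x], it lies in the neighbourhood of that
    image, which [emb_nbhd] puts inside the image of [f]; [emb_blocks] then reflects [W]. *)
Lemma embedding_closed A B (f : A -> B) :
  embedding f -> closed_emb t (blocks A) (blocks B) f.
Proof.
move=> [inj _ fblocks fnbhd]; apply/closed_embP; split=> // [M MA|W WB tW].
  by rewrite -fblocks // (card_block MA).
pose W0 := f @^-1: W.
have tW0 : t <= #|W0|.
  rewrite -(card_imset _ inj); apply: leq_trans tW _.
  apply/subset_leq_card/subsetP=> y; rewrite inE => /andP[+ /imsetP[x _ yE]].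
  by rewrite yE => fxW; rewrite imset_f // inE.
have sx : size (take t (enum W0)) == t by rewrite size_takel // -cardE.
pose x := Tuple sx.
have ux : uniq x by rewrite /= take_uniq ?enum_uniq.
have xW v : v \in x -> f v \in W.
  by move=> /mem_take; rewrite mem_enum inE.
pose T := [set v in map_tuple f x].
have cT : #|T| = t.
  rewrite cardsE; have /card_uniqP -> : uniq (map_tuple f x) by rewrite map_inj_uniq.
  by rewrite size_tuple.
have WN : W \subset nbhd T.
  apply/subsetP=> y yW; apply/bigcupP; exists W => //; rewrite WB /=.
  by apply/subsetP=> z; rewrite inE => /mapP[v vx ->]; apply: xW.
have lN : k <= #|nbhd T| <= (k - t) * lam + t.
  by have := subset_leq_card WN; rewrite (card_block WB) card_nbhd_le // andbT.
have := fnbhd _ lN x.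
rewrite {1}/nbhd_fun map_inj_uniq // ux eqxx /=.
case: nbhd_fun => [N /= [NE]|//].
have WE : W = f @: W0.
  apply/setP=> y; apply/idP/imsetP=> [yW|[v + ->]]; last by rewrite inE.
  have := subsetP WN _ yW; rewrite NE => /imsetP[v _ e].
  by exists v; rewrite // inE -e.
have := card_block WB; rewrite WE card_imset // => cW0.
by exists W0; rewrite // fblocks // -WE.
Qed.

Lemma closed_embedding A B (f : A -> B) : t <= k ->
    closed_emb t (blocks A) (blocks B) f -> {homo f : x y / vle x y} ->
  embedding f.
Proof.
move=> tk /closed_embP[inj hom cl] mono; split=> // [M cM|l _ x].
  apply/idP/idP=> [|MB]; first exact: hom.
  have [|M' M'A e] := cl _ MB; last by rewrite (imset_inj inj e).
  by rewrite (setIidPl _) ?imsetS ?subsetT // card_imset // cM.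
rewrite /nbhd_fun map_inj_uniq //; have [ux /=|//] := boolP (uniq x).
set T := [set v in x].
have TE : [set v in map_tuple f x] = f @: T.
  apply/setP=> y; rewrite inE; apply/mapP/imsetP=> -[v vx ->]; exists v => //.
    by rewrite inE.
  by rewrite inE in vx.
have cT : #|T| = t by rewrite cardsE (card_uniqP ux) size_tuple.
have NE : nbhd [set v in map_tuple f x] = f @: nbhd T.
  rewrite TE; apply/setP=> y; apply/bigcupP/imsetP=> [[W /andP[WB TW] yW]|].
    have [|M MA e] := cl W WB.
      by rewrite -{1}cT -(card_imset _ inj) subset_leq_card // subsetI TW imsetS ?subsetT.
    move: TW yW; rewrite e => TM /imsetP[v vM ->]; exists v => //.
    apply/bigcupP; exists M => //; rewrite MA; apply/subsetP=> z zT.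
    by have := subsetP TM (f z); rewrite !mem_imset //; apply.
  move=> [v /bigcupP[M /andP[MA TM] vM] ->].
  by exists (f @: M); rewrite ?imset_f // hom //= imsetS.
by rewrite NE card_imset //; case: ifP.
Qed.

Lemma induced_closed B D (g : B -> D) :
    closed_emb t (blocks B) (blocks D) g ->
  closed_emb t (blocks (induced (g @: setT))) (blocks D) val.
Proof.
move=> /closed_embP[_ _ cl]; apply/closed_embP; split=> [||W WD tW].
- exact: val_inj.
- by move=> M; rewrite inE.
- have [|M MB WE] := cl W WD.
    apply: leq_trans tW _; apply/subset_leq_card/setIS/subsetP=> z /imsetP[y _ ->].
    exact: valP.
  have e : W = val @: [set y : induced (g @: setT) | val y \in W].
    apply/setP=> z; apply/idP/imsetP=> [zW|[y + ->]]; last by rewrite inE.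
    have zg : z \in g @: setT.
      by move: zW; rewrite WE => /imsetP[v _ ->]; rewrite imset_f.
    by exists (Sub z zg); rewrite // inE.
  by exists [set y : induced (g @: setT) | val y \in W]; rewrite // inE -e.
Qed.

Definition vsort D : seq D := sort (@vle _ _ _ D) (enum D).

Lemma mem_vsort D (x : D) : x \in vsort D.
Proof. by rewrite mem_sort mem_enum. Qed.

Lemma vsort_uniq D : uniq (vsort D).
Proof. by rewrite sort_uniq enum_uniq. Qed.

Lemma size_vsort D : size (vsort D) = #|D|.
Proof. by rewrite size_sort -cardE. Qed.

Lemma vsort_sorted D : sorted (@vle _ _ _ D) (vsort D).
Proof. exact/sort_sorted/vle_total. Qed.

Lemma index_vsort D (x y : D) :
  vle x y -> x != y -> index x (vsort D) < index y (vsort D).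
Proof.
move=> xy; apply: contraR; rewrite -leqNgt => yx; apply/eqP.
apply: (@vle_anti _ _ _ D); rewrite xy.
apply: (sorted_leq_index (@vle_trans _ _ _ D) (@vle_refl D) (vsort_sorted D));
  by rewrite ?mem_vsort.
Qed.

Lemma subseq_vsort A B (f : A -> B) : injective f -> {homo f : x y / vle x y} ->
  subseq (map f (vsort A)) (vsort B).
Proof.
move=> inj mono.
suff -> : map f (vsort A) = [seq y <- vsort B | y \in map f (vsort A)].
  exact: filter_subseq.
apply: (sorted_eq (@vle_trans _ _ _ B) (@vle_anti _ _ _ B)).
- by apply: (homo_sorted mono); apply: vsort_sorted.
- by apply: (sorted_filter (@vle_trans _ _ _ B)); apply: vsort_sorted.
- apply: uniq_perm; rewrite ?filter_uniq ?map_inj_uniq ?vsort_uniq // => y.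
  by rewrite mem_filter mem_vsort andbT.
Qed.

(** * A linear order refining the order of the parts *)

Section RefinedOrder.
Variables (V : finType) (R : {set {set V}}) (n : nat) (pi : V -> 'I_n).
Hypothesis des : partial_design k t lam R.

(** Ties within a part are broken arbitrarily: the copy of [B] used at the end has at most one
    vertex in each part. *)
Definition refined_le : rel V := fun x y =>
  (pi x < pi y) || (pi x == pi y) && (enum_rank x <= enum_rank y).

Lemma refined_le_anti : antisymmetric refined_le.
Proof.
move=> x y /andP[]; rewrite /refined_le -!val_eqE /=.
case: (ltngtP (pi x) (pi y)) => //= _ xy yx.
by apply/enum_rank_inj/ord_inj/eqP; rewrite eqn_leq xy yx.
Qed.

Lemma refined_le_trans : transitive refined_le.
Proof.
move=> y x z /orP[xy|/andP[/eqP xy rxy]] /orP[yz|/andP[/eqP yz ryz]]; apply/orP.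
- by left; apply: ltn_trans yz.
- by left; rewrite -yz.
- by left; rewrite xy.
- by right; rewrite xy yz eqxx (leq_trans rxy).
Qed.

Lemma refined_le_total : total refined_le.
Proof.
move=> x y; rewrite /refined_le -!val_eqE /=.
by case: (ltngtP (pi x) (pi y)) => //= _; apply: leq_total.
Qed.

Definition refined_design : ordPD k t lam :=
  OrdPD des.1 des.2 refined_le_anti refined_le_trans refined_le_total.

End RefinedOrder.

(** * Disjoint copies of [B], one for each map to the parts *)

Section DisjointCopies.
Variables (B : ordPD k t lam) (J : finType).

Definition tagged_blocks : {set {set {ffun B -> J} * B}} :=
  [set pair beta @: (M : {set B}) | beta in [set: {ffun B -> J}], M in blocks B].

Lemma pair_closed (beta : {ffun B -> J}) : 0 < t ->
  closed_emb t (blocks B) tagged_blocks (pair beta).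
Proof.
move=> t0; apply/closed_embP; split=> [x y []|M MB|W] //.
  by apply/imset2P; exists beta M.
move=> /imset2P[gamma M _ MB ->] tM.
have /card_gt0P[z] := leq_trans t0 tM.
rewrite inE => /andP[/imsetP[x _ ->] /imsetP[y _ [-> _]]].
by exists M.
Qed.

Lemma tagged_design : 0 < t -> partial_design k t lam tagged_blocks.
Proof.
move=> t0; have pair_inj (beta : {ffun B -> J}) : injective (@pair _ B beta).
  by move=> x y [].
split=> [_ /imset2P[beta M _ MB ->]|T cT].
  by rewrite card_imset ?(card_block MB).
have [[beta x0] zT] : exists z, z \in T by apply/card_gt0P; rewrite cT.
pose T0 := pair beta @^-1: T.
have [->|/set0Pn[W0]] := eqVneq [set M in tagged_blocks | T \subset M] set0.
  by rewrite cards0.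
rewrite inE => /andP[/imset2P[beta' M _ MB ->] TM].
have bE z : z \in T -> z = (beta, z.2).
  move=> /(subsetP TM)/imsetP[y _ ->] /=.
  by have /imsetP[y' _ [->]] := subsetP TM _ zT.
have TE : T = pair beta @: T0.
  apply/setP=> z; apply/idP/imsetP=> [zT'|[x]]; last by rewrite inE => + ->.
  by exists z.2; rewrite ?inE -bE.
have cT0 : #|T0| = t by move: cT; rewrite TE card_imset.
apply: leq_trans (card_blocks_over cT0).
rewrite -(card_imset _ (imset_inj (@pair_inj beta))).
apply/subset_leq_card/subsetP=> W; rewrite inE => /andP[WR TW].
have /closed_embP[_ _ cl] := pair_closed beta t0.
have [|M' M'B e] := cl W WR.
  rewrite -[leqLHS]cT; apply/subset_leq_card.
  by rewrite subsetI TW {1}TE imsetS ?subsetT.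
rewrite e; apply/imset_f; rewrite inE M'B; apply/subsetP=> x xT.
have : (beta, x) \in pair beta @: M' by rewrite -e (subsetP TW) // TE imset_f.
by rewrite mem_imset.
Qed.

End DisjointCopies.

End OrderedDesigns.

(** * Selecting the parts by Ramsey's theorem *)

Theorem theorem3p1 (k t lam : nat) (ht : 2 <= t) (hk : t <= k) (hlam : 1 <= lam)
    (A B : ordPD k t lam) (r : nat) (hr : 0 < r) :
  exists C : ordPD k t lam,
    forall chi : {set C} -> 'I_r,
      exists2 Bt : {set C}, copy B Bt &
        exists i : 'I_r, forall At : {set C}, copy_within A Bt At -> chi At = i.
Proof.
have t0 : 0 < t by apply: leq_trans ht.
have c0 : 'I_r := Ordinal hr.
have [n ram] := ramsey c0 #|A| (#|'I_r| * #|B|).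
(* The extra part makes [J] nonempty, so that [ord0] can serve as default of [nth]. *)
pose J : finType := 'I_n.+1.
pose R0 := tagged_blocks B J.
pose pi0 (z : {ffun B -> J} * B) : J := z.1 z.2.
pose alphas := enum [pred alpha : {ffun A -> J} | injectiveb alpha].
have [|V [R [pi [des HV]]]] := partite_construction 'I_r (blocks A)
    (alphas := alphas) pi0 _ (tagged_design B J t0).
  by move=> alpha; rewrite mem_enum => /injectiveP.
exists (refined_design pi des) => chi.
have [phi [clphi piphi] monophi] := HV chi.
pose ov := copy_over t (blocks A) R0 pi0.
(* The common colour of the copies over an injective [alpha]; [c0] fills in if there are none. *)
pose kappa (alpha : {ffun A -> J}) : 'I_r :=
  if [pick h | ov alpha h] is Some h then chi (phi @: (h @: setT)) else c0.
have kappaE (alpha : {ffun A -> J}) h : injective alpha -> ov alpha h ->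
    chi (phi @: (h @: setT)) = kappa alpha.
  move=> inj oh; rewrite /kappa; case: pickP => [h' oh'|/(_ h)]; last by rewrite oh.
  by apply: (monophi alpha) => //; rewrite mem_enum; apply/injectiveP.
(* The vertices of [D], in increasing order, go to the successive entries of [u]. *)
pose place (D : ordPD k t lam) (u : seq J) : {ffun D -> J} :=
  [ffun x => nth ord0 u (index x (vsort D))].
have [||c [u uJ [szu homu]]] :=
  ram _ (enum J) (fun u => kappa (place A u)) (fun=> #|B|).
- by rewrite sum_nat_const.
- by rewrite size_enum_ord.
pose beta := place B u.
have u_sorted : sorted (fun i j : J => i < j) u.
  apply: (subseq_sorted _ uJ); first by move=> x y z; apply: ltn_trans.
  by have := iota_ltn_sorted 0 n.+1; rewrite -val_enum_ord sorted_map.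
have beta_lt x y : vle x y -> x != y -> beta x < beta y.
  move=> xy nxy; rewrite !ffunE.
  apply: (sorted_ltn_nth (leT := fun i j : J => i < j)) => //.
  - by move=> i j l; apply: ltn_trans.
  - by rewrite inE szu -size_vsort index_mem mem_vsort.
  - by rewrite inE szu -size_vsort index_mem mem_vsort.
  - exact: index_vsort.
have betaE : map beta (vsort B) = u.
  apply: (@eq_from_nth _ ord0); rewrite size_map ?size_vsort // => i lti.
  have x : B by apply: (enum_val (Ordinal lti)).
  rewrite (nth_map x) ?size_vsort // ffunE index_uniq ?vsort_uniq ?size_vsort //.
(* The copy tagged [beta] spreads [B] increasingly over the parts in [u], so [refined_le] restricts
   to the order of [B]. *)
pose g : B -> refined_design pi des := phi \o pair beta.
have clg : closed_emb t (blocks B) (blocks (refined_design pi des)) g.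
  exact: closed_emb_comp (pair_closed beta t0) clphi.
have pig x : pi (g x) = beta x by exact: piphi.
have gle x y : vle x y -> vle (g x) (g y).
  move=> xy; have [->|nxy] := eqVneq x y; first exact: vle_refl.
  by apply/orP; left; rewrite !pig; apply: beta_lt.
have gle' x y : vle (g x) (g y) -> vle x y.
  have /closed_embP[injg _ _] := clg.
  move=> gxy; have /orP[//|/gle gyx] := vle_total x y.
  rewrite (injg x y) ?vle_refl //.
  by apply: (@vle_anti _ _ _ (refined_design pi des)); rewrite gxy.
exists (g @: setT); first by exists g => //; apply: closed_embedding.
exists c => _ [U' [h emb ->] ->].
(* The copy of [A] is read back inside [B], to be lifted to the initial copy tagged [beta]. *)
have [hg hgE] : exists hg : A -> B, forall v, val (h v) = g (hg v).
  apply: (fin_all_exists (P := fun v x => val (h v) = g x)) => v.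
  have /imsetP[x _ e] := valP (h v).
  by exists x.
have clvh : closed_emb t (blocks A) (blocks (refined_design pi des)) (val \o h).
  exact: closed_emb_comp (embedding_closed emb) (induced_closed clg).
have clh : closed_emb t (blocks A) (blocks B) hg.
  apply: (closed_emb_cancel hk (@card_block _ _ _ A) _ clg).
  exact: eq_closed_emb hgE clvh.
have hgle : {homo hg : x y / vle x y}.
  by move=> x y xy; apply: gle'; rewrite -!hgE; apply: (emb_le emb xy).
have /closed_embP[injh _ _] := clh.
have inju : injective beta.
  move=> x y e; apply/eqP; apply: contraT => nxy.
  have /orP[xy|yx] := vle_total x y.
    by have := beta_lt _ _ xy nxy; rewrite e ltnn.
  by have := beta_lt _ _ yx; rewrite eq_sym nxy e ltnn => /(_ isT).
pose alpha : {ffun A -> J} := [ffun v => beta (hg v)].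
have inja : injective alpha.
  by move=> x y; rewrite [LHS]ffunE [RHS]ffunE => /inju/injh.
pose h0 : {ffun A -> {ffun B -> J} * B} := [ffun v => (beta, hg v)].
have -> : [set val x | x in h @: setT] = phi @: (h0 @: setT).
  rewrite -!imset_comp; apply: eq_imset => v; rewrite /= ffunE; exact: hgE.
rewrite (kappaE alpha) //; last first.
  apply/andP; split; last first.
    by apply/forallP=> v; rewrite ffunE [alpha v]ffunE.
  by apply: eq_closed_emb (closed_emb_comp clh (pair_closed beta t0)) => v; rewrite ffunE.
(* [alpha] places [A] increasingly on a subsequence of [u], whose colour is [c] by homogeneity. *)
have -> : alpha = place A (map alpha (vsort A)).
  apply/ffunP=> v; rewrite [RHS]ffunE (nth_map v) ?index_mem ?mem_vsort //.
  by rewrite nth_index ?mem_vsort.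
apply: homu; last by rewrite size_map size_vsort.
rewrite -betaE; have -> : map alpha (vsort A) = map beta (map hg (vsort A)).
  by rewrite -map_comp; apply: eq_map => v; rewrite ffunE.
exact/map_subseq/subseq_vsort.
Qed.
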